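(* Let $\Lambda$ be a ring such that the injective envelope $I$ of the left module ${}_\Lambda\Lambda$ is flat. Let $\mathfrak{s}$ denote the injective torsion functor on right $\Lambda$-modules. Then: \begin{enumerate} \item $\mathfrak{s}\simeq\mathrm{Tor}_1^\Lambda(\_,\Sigma\Lambda)$. \item If $0\to A'\to A\to A''\to0$ is a short exact sequence of right $\Lambda$-modules, then there is a homomorphism $\delta:\mathfrak{s}(A'')\to A'\otimes_\Lambda\Sigma\Lambda$ such that the induced sequence \[0\to\mathfrak{s}(A')\to\mathfrak{s}(A)\to\mathfrak{s}(A'')\overset{\delta}{\to}A'\otimes_\Lambda\Sigma\Lambda\to A\otimes_\Lambda\Sigma\Lambda\to A''\otimes_\Lambda\Sigma\Lambda\to0\] is exact. In particular, $\mathfrak{s}$ is left-exact. \item The natural transformation $\mathfrak{s}^2\to\mathfrak{s}$ obtained by applying $\mathfrak{s}$ to the inclusion $\mathfrak{s}\to\mathbf{1}$ is an isomorphism, i.e., $\mathfrak{s}$ is an idempotent radical and thus the torsion class of $\mathfrak{s}$ is the torsion class of a torsion theory. That torsion theory is hereditary, i.e., its torsion class is closed under submodules. \item The torsion-free class of $\mathfrak{s}$ is closed under extensions. \item The torsion class of $\mathfrak{s}$ is closed under extensions. \end{enumerate}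
   Context: Let $\iota:\Lambda\to I$ be the injective envelope of $\Lambda$ viewed as a left $\Lambda$-module, and let $\Sigma\Lambda:=I/\iota(\Lambda)$, so that $0\to\Lambda\to I\to\Sigma\Lambda\to0$ is exact. For a right $\Lambda$-module $A$, the injective torsion is $\mathfrak{s}(A):=\ker\big(1\otimes\iota: A\otimes_\Lambda\Lambda\to A\otimes_\Lambda I\big)$, identified with a submodule of $A$ via $A\otimes_\Lambda\Lambda\cong A$. $\mathbf{1}$ is the identity functor on right $\Lambda$-modules. The torsion class of $\mathfrak{s}$ consists of the right modules $A$ with $\mathfrak{s}(A)=A$; the torsion-free class consists of those with $\mathfrak{s}(A)=\{0\}$. ''Torsion theory'' is meant in the sense of Dickson. $\mathfrak{s}$ is a radical if $\mathfrak{s}(A/\mathfrak{s}(A))=0$ for all $A$. *)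

(* Defs.v *)
From HB Require Import structures.
From mathcomp Require Import all_boot all_algebra.
From mathcomp Require Import boolp functions.
From mathcomp.multinomials Require Import freeg.

Set Implicit Arguments.
Unset Strict Implicit.
Unset Printing Implicit Defensive.
Import GRing.Theory.
Local Open Scope ring_scope.
Local Open Scope quotient_scope.

(* Left modules over R are [lmodType R]; right modules over R are
   [lmodType R^c], the scalar r : R acting on the right by (r : R^c) *: a.
   The zero ring is allowed. *)

Definition surj (X Y : Type) (f : X -> Y) := forall y, exists x, f x = y.

Definition exact_at (X Y : Type) (Z : zmodType) (f : X -> Y) (g : Y -> Z) :=
  forall y, g y = 0 <-> exists x, f x = y.

Definition short_exact (X Y Z : zmodType) (f : X -> Y) (g : Y -> Z) :=
  [/\ injective f, exact_at f g & surj g].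

Definition is_zero (X : zmodType) := forall x : X, x = 0.

Section SubZmod.
Variables (M : zmodType) (S : zmodClosed M).

Record subzmod := SubZmod { subzmod_val : M; _ : subzmod_val \in S }.
HB.instance Definition _ := [isSub for subzmod_val].
HB.instance Definition _ := [Choice of subzmod by <:].
HB.instance Definition _ := [SubChoice_isSubZmodule of subzmod by <:].
End SubZmod.

Section SubMod.
Variables (R : pzRingType) (M : lmodType R) (S : submodClosed M).

Record submod := SubMod { submod_incl : M; _ : submod_incl \in S }.
HB.instance Definition _ := [isSub for submod_incl].
HB.instance Definition _ := [Choice of submod by <:].
HB.instance Definition _ := [SubChoice_isSubLmodule of submod by <:].

Fact submod_incl_linear : linear submod_incl.
Proof. exact: (linearP (\val : submod -> M)). Qed.
HB.instance Definition _ :=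
  GRing.isLinear.Build R submod M *:%R submod_incl submod_incl_linear.
End SubMod.

Section QuotMod.
Variables (R : pzRingType) (M : lmodType R) (S : submodClosed M).

Definition submod_carrier : {pred M} := fun x => x \in S.
Fact submod_carrier_closed : zmod_closed submod_carrier.
Proof.
split=> [|x y xS yS]; first exact: (rpred0 S).
have NyS : - y \in S by rewrite -scaleN1r; exact: rpredZ yS.
exact: (rpredD xS NyS).
Qed.
HB.instance Definition _ := GRing.isZmodClosed.Build M submod_carrier submod_carrier_closed.

Definition quotmod := Quotient.quot submod_carrier.
HB.instance Definition _ := GRing.Zmodule.on quotmod.

Definition quotmod_pi (x : M) : quotmod := \pi_(Quotient.quot submod_carrier) x.

Lemma quotmod_pi_eq x y : (quotmod_pi x == quotmod_pi y) = (x - y \in S).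
Proof. by rewrite /quotmod_pi -Quotient.idealrBE. Qed.

Lemma quotmod_piK (q : quotmod) : quotmod_pi (repr q) = q.
Proof. exact: reprK. Qed.

Fact quotmod_pi_additive : zmod_morphism quotmod_pi.
Proof. exact: raddfB. Qed.
HB.instance Definition _ :=
  GRing.isZmodMorphism.Build M quotmod quotmod_pi quotmod_pi_additive.

Definition quotmod_scale (r : R) (q : quotmod) := quotmod_pi (r *: repr q).

Lemma quotmod_scale_pi r x : quotmod_scale r (quotmod_pi x) = quotmod_pi (r *: x).
Proof.
apply/eqP; rewrite quotmod_pi_eq -scalerBr rpredZ //.
by rewrite -quotmod_pi_eq quotmod_piK.
Qed.

Fact quotmod_scaleA a b v :
  quotmod_scale a (quotmod_scale b v) = quotmod_scale (a * b) v.
Proof. by rewrite -[v]quotmod_piK !quotmod_scale_pi scalerA. Qed.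
Fact quotmod_scale1 : left_id 1 quotmod_scale.
Proof. by move=> v; rewrite -[v]quotmod_piK quotmod_scale_pi scale1r. Qed.
Fact quotmod_scaleDr : right_distributive quotmod_scale +%R.
Proof.
move=> a u v; rewrite -[u]quotmod_piK -[v]quotmod_piK -raddfD.
by rewrite !quotmod_scale_pi scalerDr raddfD.
Qed.
Fact quotmod_scaleDl v : {morph quotmod_scale^~ v : a b / a + b}.
Proof.
by move=> a b; rewrite -[v]quotmod_piK !quotmod_scale_pi scalerDl raddfD.
Qed.
HB.instance Definition _ := GRing.Zmodule_isLmodule.Build R quotmod
  quotmod_scaleA quotmod_scale1 quotmod_scaleDr quotmod_scaleDl.

Fact quotmod_pi_scalable : scalable quotmod_pi.
Proof. by move=> a x; rewrite -quotmod_scale_pi. Qed.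
HB.instance Definition _ :=
  GRing.isScalable.Build R M quotmod *:%R quotmod_pi quotmod_pi_scalable.
End QuotMod.

Section LinearImage.
Variables (R : pzRingType) (M N : lmodType R) (f : {linear M -> N}).

Definition lin_im : {pred N} := fun y => `[< exists x, f x = y >].
Fact lin_im_closed : submod_closed lin_im.
Proof.
split; first by apply/asboolP; exists 0; rewrite linear0.
move=> a _ _ /asboolP[x <-] /asboolP[y <-].
by apply/asboolP; exists (a *: x + y); rewrite linearP.
Qed.
HB.instance Definition _ := GRing.isSubmodClosed.Build R N lin_im lin_im_closed.

Definition cokernel := quotmod lin_im.
HB.instance Definition _ := GRing.Lmodule.on cokernel.
End LinearImage.

Section Homology.
Variables (X Y Z : zmodType) (f : {additive X -> Y}) (g : {additive Y -> Z}).

Definition cycles_pred : {pred Y} := fun y => g y == 0.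
Fact cycles_closed : zmod_closed cycles_pred.
Proof.
split=> [|x y]; rewrite !unfold_in ?raddf0 //.
by move=> /eqP gx /eqP gy; rewrite raddfB gx gy subr0.
Qed.
HB.instance Definition _ := GRing.isZmodClosed.Build Y cycles_pred cycles_closed.

Definition cycles := subzmod cycles_pred.
HB.instance Definition _ := GRing.Zmodule.on cycles.

Definition boundaries : {pred cycles} := fun y => `[< exists x, f x = \val y >].
Fact boundaries_closed : zmod_closed boundaries.
Proof.
split; first by apply/asboolP; exists 0; rewrite !raddf0.
move=> y y' /asboolP[x xE] /asboolP[x' x'E].
by apply/asboolP; exists (x - x'); rewrite !raddfB xE x'E.
Qed.
HB.instance Definition _ :=
  GRing.isZmodClosed.Build cycles boundaries boundaries_closed.

Definition homology := Quotient.quot boundaries.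
HB.instance Definition _ := GRing.Zmodule.on homology.

Definition homology_class (y : cycles) : homology :=
  \pi_(Quotient.quot boundaries) y.
Fact homology_class_additive : zmod_morphism homology_class.
Proof. exact: raddfB. Qed.
HB.instance Definition _ := GRing.isZmodMorphism.Build
  cycles homology homology_class homology_class_additive.

Lemma homology_class_repr (q : homology) : homology_class (repr q) = q.
Proof. exact: reprK. Qed.

Lemma homology_class_eq x y :
  (homology_class x == homology_class y) = (x - y \in boundaries).
Proof. by rewrite /homology_class -Quotient.idealrBE. Qed.
End Homology.

Section HomologyMap.
Variables (X Y Z X' Y' Z' : zmodType).
Variables (f : {additive X -> Y}) (g : {additive Y -> Z}).
Variables (f' : {additive X' -> Y'}) (g' : {additive Y' -> Z'}).
Variables (a : X -> X') (b : {additive Y -> Y'}) (c : {additive Z -> Z'}).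
Hypothesis (baf : forall x, b (f x) = f' (a x)).
Hypothesis (cbg : forall y, c (g y) = g' (b y)).

Fact cycles_map_subproof (y : cycles g) : b (\val y) \in cycles_pred g'.
Proof.
have /eqP gy0 : \val y \in cycles_pred g by exact: valP.
by apply/eqP; rewrite -cbg gy0 raddf0.
Qed.

Definition cycles_map (y : cycles g) : cycles g' := SubZmod (cycles_map_subproof y).

Definition homology_map (q : homology f g) : homology f' g' :=
  homology_class f' (cycles_map (repr q)).

Lemma homology_map_class y :
  homology_map (homology_class f y) = homology_class f' (cycles_map y).
Proof.
apply/eqP; rewrite homology_class_eq; apply/asboolP.
have := homology_class_repr (homology_class f y).
move=> /eqP; rewrite homology_class_eq => /asboolP[x xE].
by exists (a x); rewrite -baf xE !raddfB.
Qed.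

Fact homology_map_additive : zmod_morphism homology_map.
Proof.
move=> p q; rewrite -[p]homology_class_repr -[q]homology_class_repr.
rewrite -raddfB !homology_map_class -raddfB.
by congr homology_class; apply: val_inj; rewrite /= !raddfB.
Qed.
End HomologyMap.

Section Tensor.
Variables (R : pzRingType) (A : lmodType R^c) (M : lmodType R).

Inductive tensor_relation : {freeg (A * M) / int} -> Prop :=
| TensorRel0 : tensor_relation 0
| TensorRelB x y of tensor_relation x & tensor_relation y :
    tensor_relation (x - y)
| TensorRelDl a a' m :
    tensor_relation (<< (a + a', m) >> - << (a, m) >> - << (a', m) >>)
| TensorRelDr a m m' :
    tensor_relation (<< (a, m + m') >> - << (a, m) >> - << (a, m') >>)
| TensorRelZ a (r : R) m :
    tensor_relation (<< ((r : R^c) *: a, m) >> - << (a, r *: m) >>).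

Definition tensor_relb : {pred {freeg (A * M) / int}} :=
  fun x => `[< tensor_relation x >].
Fact tensor_relb_closed : zmod_closed tensor_relb.
Proof.
split=> [|x y /asboolP xT /asboolP yT]; apply/asboolP.
  exact: TensorRel0.
exact: TensorRelB.
Qed.
HB.instance Definition _ :=
  GRing.isZmodClosed.Build {freeg (A * M) / int} tensor_relb tensor_relb_closed.

Definition tensor := Quotient.quot tensor_relb.
HB.instance Definition _ := GRing.Zmodule.on tensor.

Definition tensor_class (x : {freeg (A * M) / int}) : tensor :=
  \pi_(Quotient.quot tensor_relb) x.
Fact tensor_class_additive : zmod_morphism tensor_class.
Proof. exact: raddfB. Qed.
HB.instance Definition _ := GRing.isZmodMorphism.Build
  {freeg (A * M) / int} tensor tensor_class tensor_class_additive.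

Lemma tensor_class_repr (t : tensor) : tensor_class (repr t) = t.
Proof. exact: reprK. Qed.

Lemma tensor_class_eq x y :
  (tensor_class x == tensor_class y) = (x - y \in tensor_relb).
Proof. by rewrite /tensor_class -Quotient.idealrBE. Qed.

Definition tens (a : A) (m : M) : tensor := tensor_class << (a, m) >>.

Definition balanced (V : zmodType) (b : A -> M -> V) :=
  [/\ forall a a' m, b (a + a') m = b a m + b a' m,
      forall a m m', b a (m + m') = b a m + b a m' &
      forall a (r : R) m, b ((r : R^c) *: a) m = b a (r *: m)].

Lemma tens_balanced : balanced tens.
Proof.
split=> *; apply/eqP; rewrite /tens -?raddfD tensor_class_eq ?opprD ?addrA;
  apply/asboolP.
- exact: TensorRelDl.
- exact: TensorRelDr.
- exact: TensorRelZ.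
Qed.

Section Lift.
Variables (V : zmodType) (b : A -> M -> V) (b_bal : balanced b).

Definition tensor_prelift (x : {freeg (A * M) / int}) : V :=
  fglift (fun am => b am.1 am.2 : zmodule V) x.

Lemma tensor_preliftU a m : tensor_prelift << (a, m) >> = b a m.
Proof. by rewrite /tensor_prelift liftU scale1r. Qed.

Lemma tensor_preliftB : {morph tensor_prelift : x y / x - y}.
Proof.
exact: (@lift_is_additive int _ (zmodule V) (fun am => b am.1 am.2 : zmodule V)).
Qed.

Lemma tensor_prelift_rel x : tensor_relation x -> tensor_prelift x = 0.
Proof.
have [bDl bDr bZ] := b_bal; elim=> [|{}x y _ x0 _ y0|a a' m|a m m'|a r m].
- by have := tensor_preliftB 0 0; rewrite !subrr.
- by rewrite tensor_preliftB x0 y0 subrr.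
- by rewrite !tensor_preliftB !tensor_preliftU bDl -addrA -opprD subrr.
- by rewrite !tensor_preliftB !tensor_preliftU bDr -addrA -opprD subrr.
- by rewrite !tensor_preliftB !tensor_preliftU bZ subrr.
Qed.

Definition tensor_lift of balanced b :=
  fun t : tensor => tensor_prelift (repr t).

Lemma tensor_lift_class x : tensor_lift b_bal (tensor_class x) = tensor_prelift x.
Proof.
apply/eqP; rewrite -subr_eq0 -tensor_preliftB; apply/eqP.
apply: tensor_prelift_rel; apply/asboolP.
by move/eqP: (tensor_class_repr (tensor_class x)); rewrite tensor_class_eq.
Qed.

Lemma tensor_lift_tens a m : tensor_lift b_bal (tens a m) = b a m.
Proof. by rewrite tensor_lift_class tensor_preliftU. Qed.

Fact tensor_lift_additive : zmod_morphism (tensor_lift b_bal).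
Proof.
move=> s t; rewrite -[s]tensor_class_repr -[t]tensor_class_repr -raddfB !tensor_lift_class.
exact: tensor_preliftB.
Qed.
End Lift.
HB.instance Definition _ V b (b_bal : @balanced V b) :=
  GRing.isZmodMorphism.Build tensor V (tensor_lift b_bal) (tensor_lift_additive b_bal).

Lemma tensor_ext (V : zmodType) (f g : {additive tensor -> V}) :
  (forall a m, f (tens a m) = g (tens a m)) -> f =1 g.
Proof.
move=> fg t; rewrite -[t]tensor_class_repr; elim/freeg_ind_dom0: (repr t) => [|k x D _ _ IH].
  by rewrite !raddf0.
rewrite !raddfD IH; congr (_ + _).
have -> : << k *g x >> = << x >> *~ k :> {freeg (A * M) / int}.
  by rewrite freegU_mulz intz.
by rewrite !raddfMz; case: x => a m; rewrite [f _]fg.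
Qed.
End Tensor.

Section TensorMap.
Variables (R : pzRingType) (A B : lmodType R^c) (M N : lmodType R).
Variables (f : {linear A -> B}) (g : {linear M -> N}).

Fact tensor_map_balanced : balanced (fun a m => tens (f a) (g m)).
Proof.
have [tDl tDr tZ] := tens_balanced B N.
by split=> *; rewrite ?linearD ?tDl ?tDr // !linearZ /= tZ.
Qed.

Definition tensor_map : tensor A M -> tensor B N := tensor_lift tensor_map_balanced.
HB.instance Definition _ := GRing.Additive.on tensor_map.

Lemma tensor_map_tens a m : tensor_map (tens a m) = tens (f a) (g m).
Proof. exact: tensor_lift_tens. Qed.
End TensorMap.
Arguments tensor_map {R A B M N}.

Section TensorUnit.
Variables (R : pzRingType) (A : lmodType R^c).

Fact tensor_unit_balanced :
  balanced (fun (a : A) (r : R^o) => (r : R^c) *: a : A).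
Proof.
split=> [a a' r|a r r'|a r r'] /=; first exact: scalerDr.
  exact: scalerDl.
by rewrite scalerA.
Qed.

Definition tensor_unit : tensor A R^o -> A := tensor_lift tensor_unit_balanced.
HB.instance Definition _ := GRing.Additive.on tensor_unit.

Definition tensor_unit_inv (a : A) : tensor A R^o := tens a (1 : R^o).

Lemma tensor_unitK : cancel tensor_unit tensor_unit_inv.
Proof.
have [tDl tDr tZ] := tens_balanced A R^o.
have invB : zmod_morphism tensor_unit_inv.
  move=> x y; apply/eqP; rewrite eq_sym subr_eq -tDl subrK //.
pose h := HB.pack_for {additive A -> tensor A R^o} tensor_unit_inv
  (GRing.isZmodMorphism.Build A (tensor A R^o) tensor_unit_inv invB).
move=> t; apply: (@tensor_ext _ _ _ _ (h \o tensor_unit) idfun) => a r /=.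
rewrite /tensor_unit tensor_lift_tens /tensor_unit_inv tZ.
by congr tens; exact: mulr1.
Qed.

Lemma tensor_unit_invK : cancel tensor_unit_inv tensor_unit.
Proof. by move=> a; rewrite /tensor_unit tensor_lift_tens scale1r. Qed.
End TensorUnit.

Section ModuleNotions.
Variable R : pzRingType.

Definition injective_module (I : lmodType R) :=
  forall (M N : lmodType R) (j : {linear M -> N}) (f : {linear M -> I}),
    injective j -> exists h : {linear N -> I}, forall x, h (j x) = f x.

Definition projective_module (P : lmodType R) :=
  forall (M N : lmodType R) (p : {linear M -> N}) (f : {linear P -> N}),
    surj p -> exists h : {linear P -> M}, forall x, p (h x) = f x.

Definition essential_mono (M I : lmodType R) (i : {linear M -> I}) :=
  injective i /\
  forall S : submodClosed I, (exists2 x, x \in S & x != 0) ->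
    exists2 m, i m \in S & i m != 0.

Record injective_envelope (M : lmodType R) := InjectiveEnvelope {
  env_mod :> lmodType R;
  env_map : {linear M -> env_mod};
  env_injective : injective_module env_mod;
  env_essential : essential_mono env_map }.

Definition flat (M : lmodType R) :=
  forall (A B : lmodType R^c) (f : {linear A -> B}),
    injective f -> injective (tensor_map f (idfun : {linear M -> M})).

Record projres (A : lmodType R) := ProjRes {
  pr_mod :> nat -> lmodType R;
  pr_diff : forall n, {linear pr_mod n.+1 -> pr_mod n};
  pr_aug : {linear pr_mod 0 -> A};
  pr_projective : forall n, projective_module (pr_mod n);
  pr_exact : forall n, exact_at (pr_diff n.+1) (pr_diff n);
  pr_exact_aug : exact_at (pr_diff 0) pr_aug;
  pr_surj : surj pr_aug }.

Record chain_lift (A B : lmodType R) (f : {linear A -> B})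
    (P : projres A) (Q : projres B) := ChainLift {
  cl_map :> forall n, {linear P n -> Q n};
  cl_diff : forall n x, cl_map n (pr_diff P n x) = pr_diff Q n (cl_map n.+1 x);
  cl_aug : forall x, f (pr_aug P x) = pr_aug Q (cl_map 0 x) }.
End ModuleNotions.

(* [Tor n P M] is Tor_n(A, M), computed from the projective resolution P of the
   right module A; the differential leaving degree 0 is the zero map. *)
Section Tor.
Variables (R : pzRingType) (M : lmodType R).

Definition tor_in (A : lmodType R^c) (P : projres A) (n : nat) :
  {additive tensor (P n.+1) M -> tensor (P n) M} := tensor_map (pr_diff P n) idfun.

Definition tor_out (A : lmodType R^c) (P : projres A) (n : nat) :
    {additive tensor (P n) M -> tensor (P n.-1) M} :=
  match n with
  | 0 => \0
  | n'.+1 => tor_in P n'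
  end.

Definition Tor (n : nat) (A : lmodType R^c) (P : projres A) :=
  homology (tor_in P n) (tor_out P n).
HB.instance Definition _ n A P := GRing.Zmodule.on (@Tor n A P).

Section Map.
Variables (A B : lmodType R^c) (f : {linear A -> B}).
Variables (P : projres A) (Q : projres B) (phi : chain_lift f P Q).

Definition tor_comp n : {additive tensor (P n) M -> tensor (Q n) M} :=
  tensor_map (phi n) idfun.

Fact tor_comp_in n x :
  tor_comp n (tor_in P n x) = tor_in Q n (tor_comp n.+1 x).
Proof.
apply: (@tensor_ext _ _ _ _ (tor_comp n \o tor_in P n)
  (tor_in Q n \o tor_comp n.+1)) => a m /=.
by rewrite !tensor_map_tens /= cl_diff.
Qed.

Fact tor_comp_out n x :
  tor_comp n.-1 (tor_out P n x) = tor_out Q n (tor_comp n x).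
Proof. by case: n x => [|n] x; [rewrite raddf0 | exact: tor_comp_in]. Qed.

Definition Tor_map (n : nat) : Tor n P -> Tor n Q :=
  homology_map (tor_in Q n) (@tor_comp_out n).
Fact Tor_map_additive n : zmod_morphism (@Tor_map n).
Proof. exact: homology_map_additive (@tor_comp_in n) (@tor_comp_out n). Qed.
HB.instance Definition _ n :=
  GRing.isZmodMorphism.Build (Tor n P) (Tor n Q) (@Tor_map n) (@Tor_map_additive n).
End Map.
End Tor.
Arguments Tor {R} M n {A} P.
Arguments Tor_map {R} M {A B f P Q} phi n.

Section InjectiveTorsion.
Variables (R : pzRingType) (I : injective_envelope R^o).

Definition Sigma := cokernel (env_map I).
HB.instance Definition _ := GRing.Lmodule.on Sigma.

Definition id_tens_iota (A : lmodType R^c) : {additive tensor A R^o -> tensor A I} :=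
  tensor_map idfun (env_map I).

(* The kernel of 1 \otimes iota, transported to A along the isomorphism
   [tensor_unit : A \otimes R -> A]. *)
Definition injtors_pred (A : lmodType R^c) : {pred A} :=
  fun a => id_tens_iota A (tensor_unit_inv a) == 0.
Arguments injtors_pred A a : clear implicits.

Lemma injtors_predE A a :
  (a \in injtors_pred A) = (tens a (env_map I (1 : R^o)) == 0).
Proof. by rewrite unfold_in /id_tens_iota /= tensor_map_tens. Qed.

(* Closure under the right action of r: as I is injective, right multiplication
   by r on R extends along iota to an endomorphism of I. *)
Fact injtors_closed A : submod_closed (injtors_pred A).
Proof.
have [tDl tDr tZ] := tens_balanced A I.
have t0 m : tens (0 : A) m = 0 :> tensor A I.
  by apply: (addrI (tens (0 : A) m)); rewrite -tDl !addr0.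
split=> [|r a b]; first by rewrite injtors_predE t0.
rewrite !injtors_predE => /eqP a0 /eqP b0; rewrite tDl b0 addr0 tZ.
have rmul_lin : linear (fun x : R^o => x * (r : R) : R^o).
  by move=> k x y; rewrite mulrDl -!mulrA.
pose rmul := HB.pack_for {linear R^o -> R^o} (fun x : R^o => x * (r : R) : R^o)
  (GRing.isLinear.Build R R^o R^o *:%R _ rmul_lin).
have [iota_inj _] := env_essential I.
have [h hE] := env_injective (env_map I \o rmul) iota_inj.
have -> : (r : R) *: env_map I (1 : R^o) = h (env_map I (1 : R^o)).
  by rewrite hE /= mul1r -linearZ; congr (env_map I _); exact: mulr1.
by rewrite -[a]/(idfun a) -tensor_map_tens a0 raddf0.
Qed.
HB.instance Definition _ A :=
  GRing.isSubmodClosed.Build R^c A (injtors_pred A) (injtors_closed A).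

Definition injtors (A : lmodType R^c) := submod (injtors_pred A).
HB.instance Definition _ A := GRing.Lmodule.on (injtors A).

Definition injtors_incl (A : lmodType R^c) : {linear injtors A -> A} :=
  @submod_incl _ _ (injtors_pred A).

Section Map.
Variables (A B : lmodType R^c) (f : {linear A -> B}).

Fact injtors_map_subproof (a : injtors A) : f (injtors_incl A a) \in injtors_pred B.
Proof.
have /eqP a0 : injtors_incl A a \in injtors_pred A by exact: (valP a).
have aE := injtors_predE (injtors_incl A a).
rewrite injtors_predE -[env_map I _]/(idfun _) -tensor_map_tens.
move: aE; rewrite (valP a) => /esym/eqP ->.
by rewrite raddf0.
Qed.

Definition injtors_map (a : injtors A) : injtors B := SubMod (injtors_map_subproof a).
Fact injtors_map_linear : linear injtors_map.
Proof. by move=> r x y; apply: val_inj; rewrite /= !linearP. Qed.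
HB.instance Definition _ := GRing.isLinear.Build R^c (injtors A) (injtors B) *:%R
  injtors_map injtors_map_linear.
End Map.

Definition torsion_class (A : lmodType R^c) := forall a : A, a \in injtors_pred A.
Definition torsion_free_class (A : lmodType R^c) := is_zero (injtors A).
End InjectiveTorsion.
Arguments injtors_pred {R} I A.
Arguments injtors_map {R} I {A B} f.
Arguments torsion_class {R} I A.
Arguments torsion_free_class {R} I A.

Section TorsionTheories.
Variable S : pzRingType.
Implicit Types T F : lmodType S -> Prop.

(* Dickson, A torsion theory for Abelian categories *)
Definition torsion_theory T F :=
  [/\ forall A, T A /\ F A <-> is_zero A,
      forall (A B : lmodType S) (p : {linear A -> B}), surj p -> T A -> T B,
      forall (A B : lmodType S) (j : {linear A -> B}), injective j -> F B -> F A &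
      forall A : lmodType S, exists (A' A'' : lmodType S)
        (j : {linear A' -> A}) (p : {linear A -> A''}),
        [/\ short_exact j p, T A' & F A'']].

Definition closed_under_submodules T :=
  forall (A B : lmodType S) (j : {linear A -> B}), injective j -> T B -> T A.

Definition closed_under_extensions T :=
  forall (A' A A'' : lmodType S) (f : {linear A' -> A}) (g : {linear A -> A''}),
    short_exact f g -> T A' -> T A'' -> T A.
End TorsionTheories.

(* Projective resolutions, and lifts of morphisms to them, always exist. *)
Section FreeModule.
Variables (S : pzRingType) (X : choiceType).

Definition finsupp : {pred X -> S^o} :=
  fun f => `[< exists s : seq X, forall x, x \notin s -> f x = 0 >].
Fact finsupp_closed : submod_closed finsupp.
Proof.
split; first by apply/asboolP; exists [::].
move=> a f g /asboolP[s fs] /asboolP[t gt]; apply/asboolP; exists (s ++ t) => x.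
rewrite mem_cat negb_or => /andP[xs xt].
rewrite -[LHS]/(a *: f x + g x) fs // gt // scaler0.
exact: addr0.
Qed.
HB.instance Definition _ :=
  GRing.isSubmodClosed.Build S (X -> S^o) finsupp finsupp_closed.

Definition free_module := submod finsupp.
HB.instance Definition _ := GRing.Lmodule.on free_module.

Definition free_supp (f : free_module) : seq X :=
  undup (projT1 (cid (asboolW (valP f)))).

Definition free_coef (f : free_module) (x : X) : S := \val f x.

Lemma free_coefP a f g x :
  free_coef (a *: f + g) x = a * free_coef f x + free_coef g x.
Proof. by rewrite /free_coef linearP. Qed.

Lemma free_suppP f x : x \notin free_supp f -> free_coef f x = 0.
Proof.
by rewrite /free_coef /free_supp mem_undup; case: cid => s /= sP; exact: sP.
Qed.

Fact free_delta_subproof (x : X) : (fun y => (y == x)%:R : S^o) \in finsupp.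
Proof.
by apply/asboolP; exists [:: x] => y; rewrite inE => /negPf ->.
Qed.
Definition free_delta x : free_module := SubMod (free_delta_subproof x).

Lemma free_coef_delta x y : free_coef (free_delta x) y = (y == x)%:R.
Proof. by []. Qed.

Section Extend.
Variables (N : lmodType S) (g : X -> N).

Definition free_ext (f : free_module) : N :=
  \sum_(x <- free_supp f) free_coef f x *: g x.

Lemma free_extE f s : uniq s -> (forall x, x \notin s -> free_coef f x = 0) ->
  free_ext f = \sum_(x <- s) free_coef f x *: g x.
Proof.
move=> s_uniq sP; pose F x := free_coef f x *: g x.
have shrink t t' : uniq t -> uniq t' -> {subset t <= t'} ->
    (forall x, x \notin t -> free_coef f x = 0) ->
    \sum_(x <- t') F x = \sum_(x <- t) F x.
  move=> ut ut' sub tP; rewrite (bigID (mem t)) /= [X in _ + X]big1 ?addr0; last first.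
    by move=> x xt; rewrite /F tP // scale0r.
  rewrite -big_filter; apply: perm_big; apply: uniq_perm => //.
    by rewrite filter_uniq.
  move=> x; rewrite mem_filter; apply/andP/idP => [[]//|xt].
  by split=> //; exact: sub.
have u1 : uniq (free_supp f) by exact: undup_uniq.
rewrite /free_ext -/(F _).
rewrite -(shrink _ (undup (free_supp f ++ s)) u1) ?undup_uniq //; first 1 last.
- by move=> x xs; rewrite mem_undup mem_cat xs.
- exact: free_suppP.
apply: shrink; rewrite ?undup_uniq // => x xs.
by rewrite mem_undup mem_cat xs orbT.
Qed.

Fact free_ext_linear : linear free_ext.
Proof.
move=> a f h; pose s := undup (free_supp f ++ free_supp h).
have us : uniq s by exact: undup_uniq.
have [sf sh] : (forall x, x \notin s -> free_coef f x = 0) /\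
    (forall x, x \notin s -> free_coef h x = 0).
  by split=> x; rewrite mem_undup mem_cat negb_or => /andP[? ?]; exact: free_suppP.
rewrite (free_extE us sf) (free_extE us sh) (free_extE (s := s)) //; last first.
  by move=> x xs; rewrite free_coefP sf // sh // mulr0 addr0.
rewrite scaler_sumr -big_split /=; apply: eq_bigr => x _.
by rewrite free_coefP scalerDl scalerA.
Qed.
HB.instance Definition _ :=
  GRing.isLinear.Build S free_module N *:%R free_ext free_ext_linear.

Lemma free_ext_delta x : free_ext (free_delta x) = g x.
Proof.
rewrite (@free_extE _ [:: x]) //= => [|y]; last by rewrite inE free_coef_delta => /negPf ->.
by rewrite big_seq1 free_coef_delta eqxx scale1r.
Qed.
End Extend.

Lemma free_ext_self f : free_ext free_delta f = f.
Proof.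
apply: val_inj; apply: funext => y; rewrite /free_ext.
rewrite -[LHS]/(free_coef _ y) -[RHS]/(free_coef f y).
have -> : free_coef (\sum_(x <- free_supp f) free_coef f x *: free_delta x) y =
    \sum_(x <- free_supp f) free_coef f x * (y == x)%:R.
  elim: (free_supp f) => [|x s IH]; first by rewrite !big_nil /free_coef raddf0.
  by rewrite !big_cons free_coefP IH free_coef_delta.
have [ys|ys] := boolP (y \in free_supp f).
  rewrite (bigD1_seq y) //=; last exact: undup_uniq.
  rewrite eqxx mulr1 big1 ?addr0 // => x; rewrite eq_sym => /negPf ->.
  exact: mulr0.
rewrite (free_suppP ys) big_seq big1 // => x xs.
have /negPf -> : y != x by apply: contra ys => /eqP ->.
exact: mulr0.
Qed.

Lemma free_module_projective : projective_module free_module.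
Proof.
move=> M N p f p_surj.
have [g gE] := choice (fun x => p_surj (f (free_delta x))).
exists (free_ext g) => x.
rewrite -[in RHS](free_ext_self x) /free_ext !linear_sum; apply: eq_bigr => y _.
by rewrite !linearZ /= gE.
Qed.

End FreeModule.

Section ResolutionsExist.
Variable S : pzRingType.

Section Kernel.
Variables (M N : lmodType S) (f : {linear M -> N}).
Definition lin_ker : {pred M} := fun x => f x == 0.
Fact lin_ker_closed : submod_closed lin_ker.
Proof.
split=> [|a x y /eqP fx /eqP fy]; apply/eqP; first exact: linear0.
by rewrite linearP fx fy scaler0 addr0.
Qed.
HB.instance Definition _ := GRing.isSubmodClosed.Build S M lin_ker lin_ker_closed.
End Kernel.

Definition free_cover (M : lmodType S) : {linear free_module S M -> M} :=
  free_ext (idfun : M -> M).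

Lemma free_cover_surj M : surj (free_cover M).
Proof. by move=> x; exists (free_delta S x); exact: free_ext_delta. Qed.

Record stage := Stage {
  stage_dom : lmodType S;
  stage_cod : lmodType S;
  stage_map : {linear stage_dom -> stage_cod} }.

Definition next_stage (s : stage) :=
  let K := lin_ker (stage_map s) in
  @Stage (free_module S (submod K)) (stage_dom s)
    (@submod_incl _ _ K \o free_cover (submod K)).

Lemma next_stage_exact s : exact_at (stage_map (next_stage s)) (stage_map s).
Proof.
move=> y; split=> [/eqP y0|[x <-]].
  have yK : y \in lin_ker (stage_map s) by [].
  have [x xE] := free_cover_surj (SubMod yK).
  by exists x; rewrite /= xE.
by apply/eqP; exact: (valP (free_cover _ x)).
Qed.

Definition free_stages (A : lmodType S) (n : nat) :=
  iter n next_stage (Stage (free_cover A)).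

Lemma free_stages_projective A n : projective_module (stage_dom (free_stages A n)).
Proof. by case: n => [|n]; exact: free_module_projective. Qed.

Definition free_resolution (A : lmodType S) : projres A :=
  @ProjRes _ A (fun n => stage_dom (free_stages A n))
    (fun n => stage_map (free_stages A n.+1)) (free_cover A)
    (@free_stages_projective A) (fun n => @next_stage_exact _)
    (@next_stage_exact _) (@free_cover_surj A).

Lemma projective_lift (P X Y : lmodType S) (d : {linear X -> Y})
    (u : {linear P -> Y}) : projective_module P ->
  (forall x, exists y, d y = u x) ->
  exists h : {linear P -> X}, forall x, d (h x) = u x.
Proof.
move=> projP uE.
have u_im x : u x \in lin_im d by apply/asboolP.
have d_im x : d x \in lin_im d by apply/asboolP; exists x.
pose u' x : submod (lin_im d) := SubMod (u_im x).
pose d' x : submod (lin_im d) := SubMod (d_im x).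
have u'_lin : linear u' by move=> a x y; apply: val_inj; rewrite /= !linearP.
have d'_lin : linear d' by move=> a x y; apply: val_inj; rewrite /= !linearP.
pose U := HB.pack_for {linear P -> submod (lin_im d)} u'
  (GRing.isLinear.Build _ _ _ _ _ u'_lin).
pose D := HB.pack_for {linear X -> submod (lin_im d)} d'
  (GRing.isLinear.Build _ _ _ _ _ d'_lin).
have D_surj : surj D.
  by move=> [y yS]; have /asboolP[x xE] := yS; exists x; apply: val_inj.
have [h hE] := projP _ _ D U D_surj.
by exists h => x; have /(congr1 val) := hE x.
Qed.

Lemma chain_lift_exists (A B : lmodType S) (f : {linear A -> B})
  (P : projres A) (Q : projres B) : inhabited (chain_lift f P Q).
Proof.
pose good n (p : {linear P n -> Q n} * {linear P n.+1 -> Q n.+1}) :=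
  forall x, p.1 (pr_diff P n x) = pr_diff Q n (p.2 x).
have [phi0 phi0E] : exists h : {linear P 0 -> Q 0},
    forall x, pr_aug Q (h x) = (f \o pr_aug P) x.
  by apply: projective_lift => [|x]; [exact: pr_projective | exact: pr_surj].
have [phi1 phi1E] : exists h : {linear P 1 -> Q 1},
    forall x, pr_diff Q 0 (h x) = (phi0 \o pr_diff P 0) x.
  apply: projective_lift => [|x]; first exact: pr_projective.
  apply: (proj1 (@pr_exact_aug _ _ Q _)); rewrite phi0E /=.
  have -> : pr_aug P (pr_diff P 0 x) = 0.
    by apply: (proj2 (@pr_exact_aug _ _ P _)); exists x.
  exact: linear0.
have step n (s : {p | good n p}) :
    {t : {p | good n.+1 p} | (sval t).1 = (sval s).2}.
  case: s => -[a b] /= ab; apply: cid.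
  have [c cE] : exists h : {linear P n.+2 -> Q n.+2},
      forall x, pr_diff Q n.+1 (h x) = (b \o pr_diff P n.+1) x.
    apply: projective_lift => [|x]; first exact: pr_projective.
    apply: (proj1 (@pr_exact _ _ Q n _)); rewrite -ab /=.
    have -> : pr_diff P n (pr_diff P n.+1 x) = 0.
      by apply: (proj2 (@pr_exact _ _ P n _)); exists x.
    exact: linear0.
  by exists (exist (good n.+1) (b, c) (fun x => esym (cE x))).
pose s0 : {p | good 0 p} :=
    exist (good 0) (phi0, phi1) (fun x => esym (phi1E x)).
pose s := nat_rect (fun n => {p | good n p}) s0 (fun n sn => sval (step n sn)).
constructor; apply: (@ChainLift _ A B f P Q (fun n => (sval (s n)).1)) => [n x|x].
  rewrite [LHS](svalP (s n) x) -[s n.+1]/(sval (step n (s n))).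
  by rewrite (svalP (step n (s n))).
by rewrite phi0E.
Qed.
End ResolutionsExist.

(* Main.v *)
(* Write e_A : A -> A (x) I for a |-> a (x) iota(1), whose kernel is s(A).
   Flatness of I makes s left exact, and the connecting map and the
   isomorphism with Tor_1 come from snake-type diagram chases; each is built
   from its graph, an additive relation shown to be total and single-valued.
   For Tor_1 the chase also uses s(P) = 0 for P projective, which reduces to
   free modules and there, by taking coordinates, to the injectivity of iota.
   Since I is injective, every x in I is h(iota(1)) for some endomorphism h of
   I, so A is torsion exactly when A (x) I = 0; likewise s(A) (x) I -> A (x) I
   is zero, and the radical property follows by right exactness. *)
Require Import Defs.
From mathcomp Require Import all_boot all_algebra.
From HB Require Import structures.
From mathcomp Require Import boolp.

Set Implicit Arguments.
Unset Strict Implicit.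
Unset Printing Implicit Defensive.
Import GRing.Theory.
Local Open Scope ring_scope.

Lemma inj_surj_bijective (X Y : Type) (f : X -> Y) : injective f -> surj f -> bijective f.
Proof.
move=> f_inj f_surj; have [g gE] := choice f_surj.
by exists g => // x; exact: f_inj.
Qed.

(** * Additive maps defined by their graphs, and exactness by factorization *)

Section Additive.
Variables (X Y : zmodType).

(** Closure under subtraction turns two values at [x] into a value at 0, so triviality at 0 gives
    single-valuedness. The equivalence keeps the whole graph available: kernels and images of [F]
    can be read off [rel]. *)
Lemma additive_of_rel (rel : X -> Y -> Prop) :
  (forall x, exists y, rel x y) ->
  (forall x x' y y', rel x y -> rel x' y' -> rel (x - x') (y - y')) ->
  (forall y, rel 0 y -> y = 0) ->
  exists F : {additive X -> Y}, forall x y, rel x y <-> F x = y.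
Proof.
move=> relT relB rel0; have [F FE] := choice relT.
have relU x y y' : rel x y -> rel x y' -> y = y'.
  move=> xy xy'; apply/eqP; rewrite -subr_eq0; apply/eqP/rel0.
  by rewrite -(subrr x); exact: relB.
have FB : zmod_morphism F by move=> x y; apply: relU (FE _) _; exact: relB.
exists (HB.pack_for {additive X -> Y} F (GRing.isZmodMorphism.Build X Y F FB)).
by move=> x y /=; split=> [|<-//]; exact: relU.
Qed.

Lemma additive_inj (f : {additive X -> Y}) :
  (forall x, f x = 0 -> x = 0) -> injective f.
Proof.
move=> f0 x y fxy; apply/eqP; rewrite -subr_eq0; apply/eqP/f0.
by rewrite raddfB fxy subrr.
Qed.

(** Turns membership in a subgroup into the vanishing of an additive map, which on a tensor product
    can be tested on pure tensors. *)
Lemma quotient_kernel (S : zmodClosed Y) :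
  exists (V : zmodType) (c : {additive Y -> V}), forall y, c y = 0 <-> y \in S.
Proof.
pose c : {additive Y -> Quotient.quot S} := \pi_(Quotient.quot S)%qT.
exists (Quotient.quot S), c => y; rewrite -[y in y \in S]subr0 Quotient.idealrBE.
rewrite -[X in _ == X]/(c 0) raddf0.
by split=> [->|/eqP].
Qed.

Section Image.
Variable f : {additive X -> Y}.

Definition add_im : {pred Y} := fun y => `[< exists x, f x = y >].
Fact add_im_closed : zmod_closed add_im.
Proof.
split; first by apply/asboolP; exists 0; rewrite raddf0.
move=> _ _ /asboolP[x <-] /asboolP[y <-].
by apply/asboolP; exists (x - y); rewrite raddfB.
Qed.
HB.instance Definition _ := GRing.isZmodClosed.Build Y add_im add_im_closed.

(** Take for [c] the cokernel of [f]: it factors through [g], so it kills the kernel of [g], which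
    therefore lies in the image of [f]. *)
Lemma exact_of_factorization (Z : zmodType) (g : {additive Y -> Z}) :
  (forall x, g (f x) = 0) ->
  (forall (V : zmodType) (c : {additive Y -> V}), (forall x, c (f x) = 0) ->
    exists h : {additive Z -> V}, forall y, h (g y) = c y) ->
  exact_at f g.
Proof.
move=> gf0 fact y; split=> [gy0|[x <-]//].
have [V [c c0]] := quotient_kernel add_im.
have [|h hE] := fact V c; first by move=> x; apply/c0/asboolP; exists x.
by apply/asboolP/c0; rewrite -hE gy0 raddf0.
Qed.
End Image.
End Additive.

Lemma homology_class_eq0 (X Y Z : zmodType)
    (f : {additive X -> Y}) (g : {additive Y -> Z}) (y : cycles g) :
  homology_class f y = 0 <-> exists x, f x = \val y.
Proof.
rewrite -(raddf0 (homology_class (g := g) f)); split=> [/eqP|fy].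
  by rewrite homology_class_eq subr0 => /asboolP.
by apply/eqP; rewrite homology_class_eq subr0; apply/asboolP.
Qed.

(** * Exactness properties of the tensor product *)

Section TensorExactness.
Variable R : pzRingType.

Lemma tens0l (A : lmodType R^c) (M : lmodType R) (m : M) : tens (0 : A) m = 0.
Proof.
have [tDl _ _] := tens_balanced A M.
by apply: (addrI (tens (0 : A) m)); rewrite -tDl !addr0.
Qed.

Lemma tens0r (A : lmodType R^c) (M : lmodType R) (a : A) : tens a (0 : M) = 0.
Proof.
have [_ tDr _] := tens_balanced A M.
by apply: (addrI (tens a (0 : M))); rewrite -tDr !addr0.
Qed.

Lemma tensor_map_square (A B B' C : lmodType R^c) (M N N' L : lmodType R)
    (f : {linear B -> C}) (f' : {linear A -> B})
    (h : {linear B' -> C}) (h' : {linear A -> B'})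
    (g : {linear N -> L}) (g' : {linear M -> N})
    (k : {linear N' -> L}) (k' : {linear M -> N'}) t :
  (forall a, f (f' a) = h (h' a)) -> (forall m, g (g' m) = k (k' m)) ->
  tensor_map f g (tensor_map f' g' t) = tensor_map h k (tensor_map h' k' t).
Proof.
move=> fh gk; apply: (@tensor_ext _ _ _ _ (tensor_map f g \o tensor_map f' g')
  (tensor_map h k \o tensor_map h' k')) => a m /=.
by rewrite !tensor_map_tens fh gk.
Qed.

Lemma tensor_map_comp (A B C : lmodType R^c) (M N L : lmodType R)
    (f : {linear B -> C}) (f' : {linear A -> B}) (h : {linear A -> C})
    (g : {linear N -> L}) (g' : {linear M -> N}) (k : {linear M -> L}) t :
  (forall a, f (f' a) = h a) -> (forall m, g (g' m) = k m) ->
  tensor_map f g (tensor_map f' g' t) = tensor_map h k t.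
Proof.
move=> fh gk; apply: (@tensor_ext _ _ _ _ (tensor_map f g \o tensor_map f' g')
  (tensor_map h k)) => a m /=.
by rewrite !tensor_map_tens fh gk.
Qed.

Lemma tensor_eq0 (A : lmodType R^c) (M : lmodType R) :
  (forall (a : A) (m : M), tens a m = 0) -> is_zero (tensor A M).
Proof.
by move=> tens0; apply: (@tensor_ext _ _ _ _ idfun \0) => a m; exact: tens0.
Qed.

(** Every pure tensor is hit, so the cokernel map vanishes on generators and hence everywhere. *)
Lemma tensor_map_surj (A B : lmodType R^c) (M N : lmodType R)
    (f : {linear A -> B}) (g : {linear M -> N}) :
  surj f -> surj g -> surj (tensor_map f g).
Proof.
move=> f_surj g_surj t; apply/asboolP; change (t \in add_im (tensor_map f g)).
have [V [c c0]] := quotient_kernel (add_im (tensor_map f g)).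
apply/c0; apply: (@tensor_ext _ _ _ _ c \0) => b n.
have [[a <-] [m <-]] := (f_surj b, g_surj n).
by apply/c0/asboolP; exists (tens a m); exact: tensor_map_tens.
Qed.

(* Right exactness in the left variable: a map killing the image of A' (x) M
   descends to A'' (x) M, its value on (g a, m) not depending on the choice of a. *)
Lemma tensor_right_exactl (M : lmodType R) (A' A A'' : lmodType R^c)
    (f : {linear A' -> A}) (g : {linear A -> A''}) :
  exact_at f g -> surj g ->
  exact_at (tensor_map f (idfun : {linear M -> M}))
           (tensor_map g (idfun : {linear M -> M})).
Proof.
move=> fg g_surj; have [tDl tDr tZ] := tens_balanced A M.
apply: exact_of_factorization => [t|V c c0].
  apply: (@tensor_ext _ _ _ _ (tensor_map g idfun \o tensor_map f idfun) \0).
  move=> a m /=; rewrite !tensor_map_tens (proj2 (fg (f a))) ?tens0l //.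
  by exists a.
have [s sE] := choice g_surj.
have cg a a' m : g a = g a' -> c (tens a m) = c (tens a' m).
  move=> gaa'; have [|x xE] := proj1 (fg (a - a')).
    by rewrite raddfB /= gaa' subrr.
  rewrite -[a](subrK a') -xE tDl raddfD /=.
  by rewrite -[m in tens (f x) m]/(idfun m) -tensor_map_tens c0 add0r.
have bal : balanced (fun a m => c (tens (s a) m)).
  split=> [a a' m|a m m'|a r m].
  - by rewrite -raddfD -tDl; apply: cg; rewrite raddfD /= !sE.
  - by rewrite -raddfD -tDr.
  - by rewrite -tZ; apply: cg; rewrite linearZ !sE.
exists (tensor_lift bal) => t.
apply: (@tensor_ext _ _ _ _ (tensor_lift bal \o tensor_map g idfun) c) => a m /=.
by rewrite tensor_map_tens tensor_lift_tens; apply: cg.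
Qed.

(** The same descent argument, now choosing preimages in [M]; it serves for iota and the projection
    onto [Sigma I]. *)
Lemma tensor_right_exactr (A : lmodType R^c) (M' M M'' : lmodType R)
    (f : {linear M' -> M}) (g : {linear M -> M''}) :
  exact_at f g -> surj g ->
  exact_at (tensor_map (idfun : {linear A -> A}) f)
           (tensor_map (idfun : {linear A -> A}) g).
Proof.
move=> fg g_surj; have [tDl tDr tZ] := tens_balanced A M.
apply: exact_of_factorization => [t|V c c0].
  apply: (@tensor_ext _ _ _ _ (tensor_map idfun g \o tensor_map idfun f) \0).
  move=> a m /=; rewrite !tensor_map_tens (proj2 (fg (f m))) ?tens0r //.
  by exists m.
have [s sE] := choice g_surj.
have cg a m m' : g m = g m' -> c (tens a m) = c (tens a m').
  move=> gmm'; have [|x xE] := proj1 (fg (m - m')).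
    by rewrite raddfB /= gmm' subrr.
  rewrite -[m](subrK m') -xE tDr raddfD /=.
  by rewrite -[a in tens a (f x)]/(idfun a) -tensor_map_tens c0 add0r.
have bal : balanced (fun a m => c (tens a (s m))).
  split=> [a a' m|a m m'|a r m].
  - by rewrite -raddfD -tDl.
  - by rewrite -raddfD -tDr; apply: cg; rewrite raddfD /= !sE.
  - by rewrite tZ; apply: cg; rewrite linearZ !sE.
exists (tensor_lift bal) => t.
apply: (@tensor_ext _ _ _ _ (tensor_lift bal \o tensor_map idfun g) c) => a m /=.
by rewrite tensor_map_tens tensor_lift_tens; apply: cg.
Qed.

(** Factor [g] through its image: right exactness handles the surjection onto [lin_im g], and
    flatness keeps the inclusion of [lin_im g] injective after tensoring. *)
Lemma flat_exact (M : lmodType R) (A' A A'' : lmodType R^c)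
    (f : {linear A' -> A}) (g : {linear A -> A''}) :
  flat M -> exact_at f g ->
  exact_at (tensor_map f (idfun : {linear M -> M}))
           (tensor_map g (idfun : {linear M -> M})).
Proof.
move=> flatM fg.
have g_im x : g x \in lin_im g by apply/asboolP; exists x.
pose g1 x : submod (lin_im g) := SubMod (g_im x).
have g1_lin : linear g1 by move=> a x y; apply: val_inj; rewrite /= !linearP.
pose G := HB.pack_for {linear A -> submod (lin_im g)} g1
  (GRing.isLinear.Build _ _ _ _ _ g1_lin).
have fG : exact_at f G.
  move=> y; split=> [Gy0|fx]; last by apply: val_inj; exact/fg.
  by apply/fg; exact: (congr1 val Gy0).
have G_surj : surj G.
  by move=> [y yS]; have /asboolP[x xE] := yS; exists x; apply: val_inj.
have im_inj := flatM _ _ (@submod_incl _ _ (lin_im g)) val_inj.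
move=> t; rewrite -(tensor_right_exactl fG G_surj t).
have <- : tensor_map (@submod_incl _ _ (lin_im g)) idfun (tensor_map G idfun t)
    = tensor_map g (idfun : {linear M -> M}) t by exact: tensor_map_comp.
split=> [Gt0|->]; first by apply: im_inj; rewrite Gt0 raddf0.
exact: raddf0.
Qed.
End TensorExactness.

(** * Torsion modules, torsion-free modules and the radical property *)

Section InjectiveTorsion.
Variables (R : pzRingType) (I : injective_envelope R^o).

(** Extend [r |-> r *: x] along iota by injectivity of [I]. The vanishing of [tens a x] for all [x]
    thus only has to be checked at iota(1). *)
Lemma env_elt_ext (x : I) : exists h : {linear I -> I}, h (env_map I (1 : R^o)) = x.
Proof.
have mul_lin : linear (fun r : R^o => (r : R) *: x).
  by move=> k r r'; rewrite scalerDl scalerA.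
pose mul := HB.pack_for {linear R^o -> I} (fun r : R^o => (r : R) *: x)
  (GRing.isLinear.Build R R^o I *:%R _ mul_lin).
have [iota_inj _] := env_essential I.
have [h hE] := env_injective mul iota_inj.
by exists h; rewrite hE /= scale1r.
Qed.

Definition env_proj : {linear I -> Sigma I} := quotmod_pi (lin_im (env_map I)).

Lemma env_proj_surj : surj env_proj.
Proof. by move=> q; exists (repr q); exact: quotmod_piK. Qed.

Lemma env_proj_exact : exact_at (env_map I) env_proj.
Proof.
move=> x; split=> [/eqP|xE].
  by rewrite -[0](raddf0 env_proj) quotmod_pi_eq subr0 => /asboolP.
apply/eqP; rewrite -[0](raddf0 env_proj) quotmod_pi_eq subr0; exact/asboolP.
Qed.

Section Unit.
Variable A : lmodType R^c.

(* The composite [A = A (x) Lambda -> A (x) I], whose kernel is s(A). *)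
Definition tens_env (a : A) : tensor A I := tens a (env_map I (1 : R^o)).
Fact tens_env_additive : zmod_morphism tens_env.
Proof.
have [tDl _ _] := tens_balanced A I.
by move=> a b; apply/eqP; rewrite eq_sym subr_eq /tens_env -tDl subrK.
Qed.
HB.instance Definition _ :=
  GRing.isZmodMorphism.Build A (tensor A I) tens_env tens_env_additive.

Lemma injtorsP a : reflect (tens_env a = 0) (a \in injtors_pred I A).
Proof. by rewrite injtors_predE; exact: eqP. Qed.

Lemma injtors_val0 (x : injtors I A) : tens_env (\val x) = 0.
Proof. exact/injtorsP/(valP x). Qed.

Definition tensor_proj : {additive tensor A I -> tensor A (Sigma I)} :=
  tensor_map idfun env_proj.

Lemma tensor_proj_surj : surj tensor_proj.
Proof. apply: tensor_map_surj env_proj_surj => a; by exists a. Qed.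

(** Right exactness of A (x) - applied to iota, with A (x) Lambda replaced by A through
    [tensor_unit]. *)
Lemma tens_env_exact : exact_at tens_env tensor_proj.
Proof.
have envE t : tensor_map idfun (env_map I) t = tens_env (tensor_unit t).
  by rewrite -[t in LHS]tensor_unitK [LHS]tensor_map_tens.
move=> t; rewrite (tensor_right_exactr env_proj_exact env_proj_surj t).
split=> -[x <-]; first by exists (tensor_unit x); rewrite envE.
by exists (tensor_unit_inv x); rewrite envE tensor_unit_invK.
Qed.

Lemma torsion_freeP :
  torsion_free_class I A <-> forall a, tens_env a = 0 -> a = 0.
Proof.
split=> [free a a0|free x]; last exact/val_inj/free/injtors_val0.
have aP : a \in injtors_pred I A by exact/injtorsP.
exact: (congr1 val (free (SubMod aP))).
Qed.

Lemma torsion_tensor_eq0 : torsion_class I A <-> is_zero (tensor A I).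
Proof.
split=> [tors|tens0 a]; last exact/injtorsP/tens0.
apply: tensor_eq0 => a x; have [h <-] := env_elt_ext x.
rewrite -[a]/((idfun : {linear A -> A}) a) -tensor_map_tens.
by rewrite -/(tens_env a) (injtorsP _ (tors a)) raddf0.
Qed.
End Unit.
Arguments tensor_proj {A}.

Section Naturality.
Variables (A B : lmodType R^c) (f : {linear A -> B}).

Lemma tens_env_map a : tensor_map f idfun (tens_env a) = tens_env (f a).
Proof. exact: tensor_map_tens. Qed.

Lemma tensor_proj_map t :
  tensor_map f idfun (tensor_proj t) = tensor_proj (tensor_map f idfun t).
Proof. exact: tensor_map_square. Qed.

Lemma torsion_class_surj : surj f -> torsion_class I A -> torsion_class I B.
Proof.
move=> f_surj torsA b; have [a <-] := f_surj b; apply/injtorsP.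
by rewrite -tens_env_map (injtorsP _ (torsA a)) raddf0.
Qed.

Lemma torsion_free_class_inj :
  injective f -> torsion_free_class I B -> torsion_free_class I A.
Proof.
move=> f_inj /torsion_freeP freeB; apply/torsion_freeP => a a0.
apply: f_inj; rewrite raddf0; apply: freeB.
by rewrite -tens_env_map a0 raddf0.
Qed.
End Naturality.

Lemma injtors_torsion_tensor_incl (A : lmodType R^c) (t : tensor (injtors I A) I) :
  tensor_map (injtors_incl I A) idfun t = 0.
Proof.
apply: (@tensor_ext _ _ _ _ (tensor_map (injtors_incl I A) idfun) \0) => a x /=.
have [h <-] := env_elt_ext x; rewrite tensor_map_tens.
rewrite -[X in tens X _]/((idfun : {linear A -> A}) (\val a)).
by rewrite -[X in tens _ X]/(h _) -tensor_map_tens -/(tens_env _) injtors_val0 raddf0.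
Qed.

Lemma quotmod_exact (S : pzRingType) (M : lmodType S) (N : submodClosed M) :
  short_exact (@submod_incl _ _ N) (@quotmod_pi _ _ N).
Proof.
split=> [|x|q]; [exact: val_inj| |by exists (repr q); exact: quotmod_piK].
have piE z : (quotmod_pi N z == 0) = (z \in N).
  by rewrite -[0](raddf0 (quotmod_pi N)) quotmod_pi_eq subr0.
split=> [/eqP|[y <-]]; last by apply/eqP; rewrite piE; exact: (valP y).
by rewrite piE => xN; exists (SubMod xN).
Qed.

(** The image of s(A) (x) I in A (x) I is zero, so by right exactness A (x) I embeds in (A/s(A)) (x)
    I. A class killed by [tens_env] thus has its representatives in s(A). *)
Lemma injtors_radical (A : lmodType R^c) :
  torsion_free_class I (quotmod (injtors_pred I A)).
Proof.
have [_ ex piS] := quotmod_exact (injtors_pred I A).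
apply/torsion_freeP => q; have [a <-] := piS q.
move=> a0; have /(tensor_right_exactl ex piS)[t] :
    tensor_map (quotmod_pi (injtors_pred I A)) (idfun : {linear I -> I}) (tens_env a) = 0.
  by rewrite tens_env_map.
rewrite (injtors_torsion_tensor_incl t) => /esym {}a0.
apply/ex; have aP : a \in injtors_pred I A by exact/injtorsP.
by exists (SubMod aP).
Qed.

(** Since A' (x) I = 0, right exactness makes A (x) I -> A'' (x) I injective, and there a (x)
    iota(1) goes to 0. *)
Lemma torsion_class_extension : closed_under_extensions (torsion_class I).
Proof.
move=> A' A A'' f g [f_inj fg g_surj] /torsion_tensor_eq0 tors' tors'' a.
apply/injtorsP.
have /(tensor_right_exactl fg g_surj)[t <-] :
    tensor_map g (idfun : {linear I -> I}) (tens_env a) = 0.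
  by rewrite tens_env_map; exact/injtorsP/tors''.
by rewrite (tors' t) raddf0.
Qed.

(* Coordinates embed s(F), F free, in copies of the kernel of iota. *)
Lemma free_torsion_free (X : choiceType) : torsion_free_class I (free_module R^c X).
Proof.
apply/torsion_freeP => f f0; apply: val_inj; apply: funext => x.
have bal : balanced (fun (h : free_module R^c X) (m : I) => (free_coef h x : R) *: m).
  split=> [h h' m|h m m'|h r m]; first 1 last.
  - exact: scalerDr.
  - rewrite -[_ *: h]addr0 free_coefP scalerA; congr (_ *: _).
    by rewrite -[free_coef 0 x]/(0 : R) addr0.
  - by rewrite -[h]scale1r free_coefP mul1r scale1r scalerDl.
have := tensor_lift_tens bal f (env_map I (1 : R^o)).
rewrite -/(tens_env f) f0 raddf0 -linearZ /= => /esym.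
rewrite -[RHS](raddf0 (env_map I)).
have [iota_inj _] := env_essential I.
by move=> /iota_inj; rewrite [_ *: _]mulr1.
Qed.

(** A section of the free cover embeds [P] in a free module. *)
Lemma projective_torsion_free (P : lmodType R^c) :
  projective_module P -> torsion_free_class I P.
Proof.
move=> projP; have [h hE] := projP _ _ _ idfun (@free_cover_surj _ P).
apply: (@torsion_free_class_inj _ _ h _ (@free_torsion_free P)).
exact: can_inj hE.
Qed.

(** * Consequences of the flatness of [I] *)

Section Flat.
Hypothesis flatI : flat I.

(** Flatness makes A (x) I -> B (x) I injective. With functoriality, s(A) is the preimage of s(B):
    the source of left exactness, idempotence and heredity. *)
Lemma injtors_mono (A B : lmodType R^c) (f : {linear A -> B}) a :
  injective f -> f a \in injtors_pred I B -> a \in injtors_pred I A.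
Proof.
move=> f_inj /injtorsP fa0; apply/injtorsP.
by apply: (flatI f_inj); rewrite tens_env_map fa0 raddf0.
Qed.

Lemma injtors_left_exact (A' A A'' : lmodType R^c)
    (f : {linear A' -> A}) (g : {linear A -> A''}) :
  injective f -> exact_at f g ->
  injective (injtors_map I f) /\ exact_at (injtors_map I f) (injtors_map I g).
Proof.
move=> f_inj fg; split=> [x y /(congr1 val)/f_inj/val_inj//|y].
split=> [/(congr1 val)/fg[a' fa']|[x <-]].
  have a'P : a' \in injtors_pred I A'.
    by apply: (injtors_mono f_inj); rewrite fa'; exact: (valP y).
  by exists (SubMod a'P); apply: val_inj.
by apply: val_inj; apply/fg; exists (\val x).
Qed.

Lemma injtors_incl_bijective (A : lmodType R^c) :
  bijective (injtors_map I (injtors_incl I A)).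
Proof.
apply: inj_surj_bijective => [x y xy|y].
  by do 2!apply: val_inj; exact: (congr1 val xy).
have yP : y \in injtors_pred I (injtors I A).
  by apply: (@injtors_mono _ _ (injtors_incl I A)); [exact: val_inj|exact: (valP y)].
by exists (SubMod yP); apply: val_inj.
Qed.

Lemma torsion_class_submodule : closed_under_submodules (torsion_class I).
Proof. by move=> A B j j_inj torsB a; exact: injtors_mono j_inj (torsB _). Qed.

(** The decomposing sequence is s(A) -> A -> A/s(A): its left term is torsion by [injtors_mono], its
    right term torsion-free by [injtors_radical]. *)
Lemma injtors_torsion_theory :
  torsion_theory (torsion_class I) (torsion_free_class I).
Proof.
split=> [A|A B p|A B j|A].
- split=> [[tors /torsion_freeP free] a|A0]; first exact/free/injtorsP/tors.
  split=> [a|x]; last exact/val_inj/A0.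
  by rewrite [a]A0; apply/injtorsP; rewrite raddf0.
- exact: torsion_class_surj.
- exact: torsion_free_class_inj.
- exists (injtors I A), (quotmod (injtors_pred I A)), (injtors_incl I A).
  exists (quotmod_pi (injtors_pred I A)); split; first exact: quotmod_exact.
    by move=> a; apply: (@injtors_mono _ _ (injtors_incl I A));
      [exact: val_inj|exact: (valP a)].
  exact: injtors_radical.
Qed.

(** A torsion element of [A] dies in [A''], so it comes from [A']; flatness makes its preimage
    torsion, hence 0. *)
Lemma torsion_free_class_extension : closed_under_extensions (torsion_free_class I).
Proof.
move=> A' A A'' f g [f_inj fg _] /torsion_freeP free' /torsion_freeP free''.
apply/torsion_freeP => a a0.
have /fg[a' a'E] : g a = 0 by apply: free''; rewrite -tens_env_map a0 raddf0.
rewrite -a'E [a']free' ?raddf0 //.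
by apply: (flatI f_inj); rewrite tens_env_map a'E a0 raddf0.
Qed.

(** The snake map: lift [x] to [a], pull a (x) iota(1) back to A' (x) I, then project to A' (x)
    Sigma. *)
Lemma injtors_long_exact (A' A A'' : lmodType R^c)
    (f : {linear A' -> A}) (g : {linear A -> A''}) :
  short_exact f g ->
  exists delta : {additive injtors I A'' -> tensor A' (Sigma I)},
    exact_at (injtors_map I g) delta /\
    exact_at delta (tensor_map f (idfun : {linear Sigma I -> Sigma I})).
Proof.
move=> [f_inj fg g_surj].
pose rel (x : injtors I A'') z := exists a t,
  [/\ g a = \val x, tensor_map f (idfun : {linear I -> I}) t = tens_env a &
      tensor_proj t = z].
have [x|x x' z z'|z|delta deltaP] := @additive_of_rel _ _ rel.
- have [a ax] := g_surj (\val x).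
  have /(tensor_right_exactl fg g_surj)[t tE] :
      tensor_map g (idfun : {linear I -> I}) (tens_env a) = 0.
    by rewrite tens_env_map ax injtors_val0.
  by exists (tensor_proj t), a, t.
- move=> [a [t [ax ta tz]]] [a' [t' [ax' ta' tz']]].
  by exists (a - a'), (t - t'); rewrite !raddfB /= ax ax' ta ta' tz tz'.
(* Over [x = 0] the lift is [f a'], and flatness forces [t = tens_env a'], which dies in A' (x)
   Sigma. *)
- move=> [a [t [/fg[a' <-] ta <-]]]; apply/tens_env_exact; exists a'.
  by apply: (flatI f_inj); rewrite tens_env_map ta.
exists delta; split=> [x|z]; split.
(* Here [t = tens_env a'], so subtracting [f a'] makes the lift [a] torsion without changing its
   image in [A'']. *)
- move=> /deltaP[a [t [ax ta /tens_env_exact[a' a't]]]].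
  have aP : a - f a' \in injtors_pred I A.
    by apply/injtorsP; rewrite raddfB /= -tens_env_map a't ta subrr.
  exists (SubMod aP); apply: val_inj; rewrite /= raddfB /= ax.
  by rewrite (proj2 (fg (f a'))) ?subr0 //; exists a'.
(* The lift is itself torsion, so [tens_env] kills it and [t] can be 0. *)
- move=> [a <-]; apply/deltaP; exists (\val a), 0.
  by rewrite !raddf0 injtors_val0.
- have [t <-] := tensor_proj_surj z.
  rewrite tensor_proj_map => /tens_env_exact[a ta].
  have xP : g a \in injtors_pred I A''.
    apply/injtorsP; rewrite -tens_env_map ta.
    by apply/(tensor_right_exactl fg g_surj); exists t.
  by exists (SubMod xP); apply/deltaP; exists a, t.
- move=> [x /deltaP[a [t [_ ta <-]]]].
  by rewrite tensor_proj_map ta; apply/tens_env_exact; exists a.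
Qed.

(* The graph of the isomorphism s(A) = Tor_1(A, Sigma), by diagram chase in
   P (x) Lambda -> P (x) I -> P (x) Sigma for a projective resolution P. *)
Definition injtors_tor_rel (A : lmodType R^c) (P : projres A)
    (x : injtors I A) (q : Tor (Sigma I) 1 P) :=
  exists p t (z : cycles (tor_out (Sigma I) P 1)),
    [/\ pr_aug P p = \val x,
        tensor_map (pr_diff P 0) (idfun : {linear I -> I}) t = tens_env p,
        tensor_proj t = \val z &
        homology_class (tor_in (Sigma I) P 1) z = q].

(** Flatness gives exactness of P (x) I in degree 1, whence single-valuedness; s(P 0) = 0 gives
    injectivity. The graph stays in the statement so that naturality can be checked on
    representatives. *)
Lemma injtors_tor_iso (A : lmodType R^c) (P : projres A) :
  exists theta : {additive injtors I A -> Tor (Sigma I) 1 P},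
    bijective theta /\ forall x q, injtors_tor_rel x q <-> theta x = q.
Proof.
have [x|x x' q q'|q|theta thetaP] :=
  @additive_of_rel _ _ (@injtors_tor_rel A P).
- have [p px] := @pr_surj _ _ P (\val x).
  have /(tensor_right_exactl (@pr_exact_aug _ _ P) (@pr_surj _ _ P))[t tp] :
      tensor_map (pr_aug P) (idfun : {linear I -> I}) (tens_env p) = 0.
    by rewrite tens_env_map px injtors_val0.
  have zP : tensor_proj t \in cycles_pred (tor_out (Sigma I) P 1).
    by apply/eqP; rewrite [LHS]tensor_proj_map tp; apply/tens_env_exact; exists p.
  by exists (homology_class _ (SubZmod zP)), p, t, (SubZmod zP).
- move=> [p [t [z [px tp tz <-]]]] [p' [t' [z' [px' tp' tz' <-]]]].
  by exists (p - p'), (t - t'), (z - z'); rewrite !raddfB /= px px' tp tp' tz tz'.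
(* Over [x = 0], [p] is the boundary of some [p1], and [t] differs from [tens_env p1] by the
   boundary of some [u]; hence [z] is the boundary of [tensor_proj u]. *)
- move=> [p [t [z [/(@pr_exact_aug _ _ P)[p1 <-] tp tz <-]]]].
  have /(flat_exact flatI (@pr_exact _ _ P 0))[u uE] :
      tensor_map (pr_diff P 0) (idfun : {linear I -> I}) (t - tens_env p1) = 0.
    by rewrite raddfB /= tp tens_env_map subrr.
  apply/homology_class_eq0; exists (tensor_proj u).
  rewrite [LHS]tensor_proj_map uE.
  rewrite raddfB /= tz (proj2 (tens_env_exact _)) ?subr0 //; by exists p1.
exists theta; split=> //; apply: inj_surj_bijective => [|q].
  (* If [z] bounds [tensor_proj u], correcting [t] by the boundary of [u] gives some [tens_env p1].
     Then [p] minus the boundary of [p1] lies in s(P 0) = 0, so the augmentation kills [p]. *)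
  apply: additive_inj => x /thetaP[p [t [z [px tp tz /homology_class_eq0[w]]]]].
  have [u <-] := tensor_proj_surj w; rewrite -tz => uE0.
  have uE : tensor_proj (tensor_map (pr_diff P 1) idfun u) = tensor_proj t.
    by rewrite -tensor_proj_map.
  have /tens_env_exact[p1 p1E] :
      tensor_proj (t - tensor_map (pr_diff P 1) (idfun : {linear I -> I}) u) = 0.
    by rewrite raddfB /= uE subrr.
  have /torsion_freeP P0 := projective_torsion_free (@pr_projective _ _ P 0).
  have dd v : tensor_map (pr_diff P 0) (idfun : {linear I -> I})
      (tensor_map (pr_diff P 1) idfun v) = 0.
    by apply/(flat_exact flatI (@pr_exact _ _ P 0)); exists v.
  have p0 : p - pr_diff P 0 p1 = 0.
    by apply: P0; rewrite raddfB /= -tens_env_map p1E raddfB /= tp (dd u) subr0 subrr.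
  apply: val_inj; rewrite -[LHS]px; apply/(@pr_exact_aug _ _ P).
  by exists p1; apply/esym/eqP; rewrite -subr_eq0 p0.
(* Surjectivity runs the chase backwards: lift the cycle [z] to [t]; its boundary projects to 0, so
   it is some [tens_env p], and the augmentation of [p] is torsion. *)
rewrite -[q]homology_class_repr; set z := repr q.
have [t tz] := tensor_proj_surj (\val z).
have /eqP : \val z \in cycles_pred (tor_out (Sigma I) P 1) by exact: valP.
rewrite -tz => dt0.
have /tens_env_exact[p tp] :
    tensor_proj (tensor_map (pr_diff P 0) (idfun : {linear I -> I}) t) = 0.
  by rewrite -tensor_proj_map.
have xP : pr_aug P p \in injtors_pred I A.
  apply/injtorsP; rewrite -tens_env_map tp.
  by apply/(tensor_right_exactl (@pr_exact_aug _ _ P) (@pr_surj _ _ P)); exists t.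
by exists (SubMod xP); apply/thetaP; exists p, t, z.
Qed.

(** The chain lift carries witnesses [p], [t], [z] to witnesses, so no choice enters. *)
Lemma injtors_tor_rel_map (A B : lmodType R^c) (f : {linear A -> B})
    (P : projres A) (Q : projres B) (phi : chain_lift f P Q) x q :
  injtors_tor_rel x q ->
  injtors_tor_rel (injtors_map I f x) (Tor_map (Sigma I) phi 1 q).
Proof.
move=> [p [t [z [px tp tz <-]]]].
exists (phi 0 p), (tensor_map (phi 1) idfun t).
exists (cycles_map (tor_comp_out phi (n := 1)) z); split.
- by rewrite -cl_aug px.
- rewrite -tens_env_map -tp; apply: tensor_map_square => // a.
  by rewrite cl_diff.
- by rewrite -tensor_proj_map tz.
- exact/esym/(homology_map_class (tor_comp_in (M := Sigma I) phi (n := 1))).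
Qed.

End Flat.
End InjectiveTorsion.

Theorem proposition2p37 (Lambda : pzRingType) (I : injective_envelope Lambda^o)
    (flatI : flat I) :
  [/\ (* s is naturally isomorphic to Tor_1(_, Sigma Lambda) *)
      forall P : (forall A : lmodType Lambda^c, projres A),
        exists theta : forall A : lmodType Lambda^c,
            {additive injtors I A -> Tor (Sigma I) 1 (P A)},
          (forall A : lmodType Lambda^c, bijective (theta A)) /\
          (forall (A B : lmodType Lambda^c) (f : {linear A -> B})
             (phi : chain_lift f (P A) (P B)) (x : injtors I A),
             Tor_map (Sigma I) phi 1 (theta A x) = theta B (injtors_map I f x)),
      (* the long exact sequence, and left-exactness of s *)
      (forall (A' A A'' : lmodType Lambda^c)
          (f : {linear A' -> A}) (g : {linear A -> A''}),
        short_exact f g ->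
        exists delta : {additive injtors I A'' -> tensor A' (Sigma I)},
          let f1 := tensor_map f (idfun : {linear Sigma I -> Sigma I}) in
          let g1 := tensor_map g (idfun : {linear Sigma I -> Sigma I}) in
          injective (injtors_map I f) /\
          exact_at (injtors_map I f) (injtors_map I g) /\
          exact_at (injtors_map I g) delta /\
          exact_at delta f1 /\
          exact_at f1 g1 /\
          surj g1) /\
      (forall (A' A A'' : lmodType Lambda^c)
          (f : {linear A' -> A}) (g : {linear A -> A''}),
        injective f -> exact_at f g ->
        injective (injtors_map I f) /\
        exact_at (injtors_map I f) (injtors_map I g)),
      (* s is an idempotent radical; its torsion class is the torsion class
         of a hereditary torsion theory *)
      (forall A : lmodType Lambda^c, bijective (injtors_map I (injtors_incl I A))) /\
      (forall A : lmodType Lambda^c,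
        is_zero (injtors I (quotmod (injtors_pred I A)))) /\
      (exists F : lmodType Lambda^c -> Prop, torsion_theory (torsion_class I) F) /\
      closed_under_submodules (torsion_class I),
      closed_under_extensions (torsion_free_class I)
    & closed_under_extensions (torsion_class I)].
Proof.
split.
- move=> P; pose iso A := cid (injtors_tor_iso flatI (P A)).
  exists (fun A => sval (iso A)); split=> [A|A B f phi x].
    exact: (proj1 (svalP (iso A))).
  have [_ isoA] := svalP (iso A); have [_ isoB] := svalP (iso B).
  (* Each component of [theta] is determined by its graph, so naturality of the relation is
     naturality of [theta]. *)
  by apply/esym/isoB/injtors_tor_rel_map/isoA.
- split=> [A' A A'' f g fg|A' A A'' f g]; last exact: injtors_left_exact.
  have [f_inj ex g_surj] := fg.
  have [delta [exg exd]] := injtors_long_exact flatI fg.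
  have [sf_inj sfg] := injtors_left_exact flatI f_inj ex.
  exists delta => f1 g1; do 4!split=> //; split; first exact: tensor_right_exactl.
  by apply: tensor_map_surj g_surj _ => x; exists x.
- split; first exact: injtors_incl_bijective.
  split; first exact: injtors_radical.
  split; last exact: torsion_class_submodule.
  by exists (torsion_free_class I); exact: injtors_torsion_theory.
- exact: torsion_free_class_extension.
- exact: torsion_class_extension.
Qed.
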